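(* Let $\mu\in\mathbb{R}$, $0\le\rho\le1$ and $x_{max}>0$ be fixed. For $k>0$ and $h=x_{max}/J$ with integer $J\ge2$, consider the Milstein finite difference scheme $$v_j^{n+1}=v_j^n-\frac{\mu k+\sqrt{\rho k}\,Z_n}{2h}\left(v_{j+1}^n-v_{j-1}^n\right)+\frac{(1-\rho)k+\rho kZ_n^2}{2h^2}\left(v_{j+1}^n-2v_j^n+v_{j-1}^n\right),\qquad 1\le j\le J-1,$$ with boundary conditions $v_0^n=v_J^n=0$ for all $n$, where $Z_0,Z_1,\dots$ are independent standard normal random variables, and let $V_n=(v_1^n,\dots,v_{J-1}^n)^T$. Then, in the limit $h,\,k/h\to0$, the Fourier stability condition $$\sup_{\theta}\left\{|a(\theta)+c(\theta)|^2+|b(\theta)|^2+2|c(\theta)|^2\right\}\le1$$ is a sufficient condition for mean-square stability of the initial-boundary value problem: there exists $\delta>0$ such that whenever $h<\delta$, $k/h<\delta$ and $\sup_{\theta}\left\{|a(\theta)+c(\theta)|^2+|b(\theta)|^2+2|c(\theta)|^2\right\}\le1$, one has $\mathbb{E}[V_{n+1}^TV_{n+1}]\le\mathbb{E}[V_n^TV_n]$ for all $n\ge0$.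
   Context: The functions appearing in the Fourier stability condition are, for $|\theta|\le\pi$, $$a(\theta)=1-\frac{i\mu k}{h}\sin\theta-\frac{2(1-\rho)k}{h^2}\sin^2\tfrac{\theta}{2},\qquad b(\theta)=-\frac{i\sqrt{\rho k}}{h}\sin\theta,\qquad c(\theta)=-\frac{2\rho k}{h^2}\sin^2\tfrac{\theta}{2},$$ so that Fourier modes $v_j^n=g_n\exp(ij\theta)$ of the scheme without boundary conditions satisfy $g_{n+1}=(a(\theta)+b(\theta)Z_n+c(\theta)Z_n^2)g_n$. The initial vector $V_0\in\mathbb{R}^{J-1}$ is deterministic (or square-integrable and independent of the $Z_n$). The scheme discretises the SPDE $\mathrm{d}v=-\mu v_x\,\mathrm{d}t+\frac12v_{xx}\,\mathrm{d}t-\sqrt{\rho}\,v_x\,\mathrm{d}M_t$ on $(0,x_{max})$ with zero Dirichlet boundary conditions. *)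

(* Defs.v *)
From HB Require Import structures.
From mathcomp Require Import all_boot all_order all_algebra.
From mathcomp Require Import complex.
From mathcomp Require Import all_classical all_reals all_analysis.

Set Implicit Arguments.
Unset Strict Implicit.
Unset Printing Implicit Defensive.

Import Order.TTheory GRing.Theory Num.Theory.
Import numFieldNormedType.Exports.

Local Open Scope classical_set_scope.
Local Open Scope ring_scope.

Section Symbols.
Variables (R : realType) (mu rho k h : R).
Local Open Scope complex_scope.

Definition symbol_a (theta : R) : R[i] :=
  1 - 'i%C * (mu * k / h * sin theta)%:C
    - (2 * (1 - rho) * k / h ^+ 2 * sin (theta / 2) ^+ 2)%:C.

Definition symbol_b (theta : R) : R[i] :=
  - ('i%C * (Num.sqrt (rho * k) / h * sin theta)%:C).

Definition symbol_c (theta : R) : R[i] :=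
  - (2 * rho * k / h ^+ 2 * sin (theta / 2) ^+ 2)%:C.

(* [normc] is the complex modulus with values in [R]; the generic norm on
   [R[i]] takes its values in [R[i]]. *)
Definition amplification (theta : R) : R :=
  Normc.normc (symbol_a theta + symbol_c theta) ^+ 2
  + Normc.normc (symbol_b theta) ^+ 2
  + 2 * Normc.normc (symbol_c theta) ^+ 2.

Definition fourier_stable : Prop :=
  (ereal_sup
     [set (amplification theta)%:E | theta in [set t | - pi <= t <= pi]%R]
   <= 1)%E.

End Symbols.

Section Scheme.
Variables (R : realType) (T : Type).

(* [v n j] is the value at time step [n] and grid point [j], with
   [0 <= j <= J]; values at [j > J] play no role. *)
Definition milstein_scheme (mu rho k h : R) (J : nat)
    (Z : nat -> T -> R) (v : nat -> nat -> T -> R) : Prop :=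
  (forall n w, v n 0%N w = 0 /\ v n J w = 0) /\
  (forall n j w, (1 <= j <= J.-1)%N ->
    v n.+1 j w =
      v n j w
      - (mu * k + Num.sqrt (rho * k) * Z n w) / (2 * h)
        * (v n j.+1 w - v n j.-1 w)
      + ((1 - rho) * k + rho * k * Z n w ^+ 2) / (2 * h ^+ 2)
        * (v n j.+1 w - 2 * v n j w + v n j.-1 w)).

Definition interior_vector (J : nat) (v : nat -> nat -> T -> R)
    (n : nat) (w : T) : 'cV[R]_(J.-1) :=
  \col_(j < J.-1) v n j.+1 w.

End Scheme.

Section Independence.
Context d (T : measurableType d) (R : realType) (P : probability T R).

Definition mutually_independent (X : nat -> T -> R) : Prop :=
  forall (s : seq nat) (B : nat -> set R),
    uniq s -> (forall i, measurable (B i)) ->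
    P (\bigcap_(i in [set` s]) (X i @^-1` B i))
    = (\prod_(i <- s) P (X i @^-1` B i))%E.

Definition independent_classes (F G : set (set T)) : Prop :=
  forall A B, F A -> G B -> P (A `&` B) = (P A * P B)%E.

(* the sigma-algebra generated by a sequence of real functions; its finite
   counterpart is the library's [g_sigma_preimage] *)
Definition sigma_sequence (X : nat -> T -> R) : set (set T) :=
  <<s \bigcup_i preimage_set_system setT (X i) measurable >>.

Definition standard_normal (X : {RV P >-> R}) : Prop :=
  forall B : set R, measurable B -> distribution P X B = normal_prob 0 1 B.

End Independence.

(* Main.v *)
(** Write [lam = k / h^2] and [nu = mu k / h].  With [s = sin^2 (theta/2)] the
    stability function equals [1 + 4 s (c0 (1 - s) + c1 s)], where
    [c0 = nu^2 + rho lam - lam] and [c1 = lam^2 + 2 rho^2 lam^2 - lam], so the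
    Fourier condition amounts to [c0 <= 0] and [c1 <= 0], and it forces
    [|nu| <= 1].  Averaging one step over the standard normal [Z_n], which is
    independent of the past, turns the energy of step [n + 1] into a sum over
    the grid of [v_j^2 + c0/4 (A v)_j^2 + c1/4 (L v)_j^2], with [A], [L] the
    first and second central differences, plus a telescoping flux.  By the
    Dirichlet conditions the total flux is
    [- lam/2 ((1 + nu) v_{J-1}^2 + (1 - nu) v_1^2)], which is nonpositive as
    [|nu| <= 1]. *)

Require Import Defs.
From HB Require Import structures.
From mathcomp Require Import all_boot all_order all_algebra.
From mathcomp Require Import complex.
From mathcomp Require Import ring lra.
From mathcomp Require Import all_classical all_reals all_analysis.
From mathcomp Require Import measurable_realfun.

Set Implicit Arguments.
Unset Strict Implicit.
Unset Printing Implicit Defensive.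

Import Order.TTheory GRing.Theory Num.Theory.
Import numFieldNormedType.Exports.

Local Open Scope classical_set_scope.
Local Open Scope ring_scope.

(** * Energy identity for one averaged step and its summation over the grid *)

Section energy.
Variables (R : realType) (lam nu rho : R).

(* The second moment, over the normal increment, of the new value at a grid
   point with old value [y] and old neighbours [x] and [z]. *)
Definition step_energy (x y z : R) : R :=
  (y - nu / 2 * (z - x) + lam / 2 * (z - 2 * y + x)) ^+ 2
  + rho * lam / 4 * (z - x) ^+ 2
  + 2 * (rho * lam / 2 * (z - 2 * y + x)) ^+ 2.

(** Found as what remains of [step_energy] once [y ^+ 2] and the squares of the two central
    differences are split off: the remainder is a difference of this function at neighbouring pairs,
    so it telescopes. *)
Definition energy_flux (x y : R) : R :=
  lam / 2 * (y ^+ 2 - x ^+ 2) - nu * (x * y) - nu * lam / 2 * (y - x) ^+ 2.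

Lemma step_energyE x y z :
  step_energy x y z = y ^+ 2
    + (nu ^+ 2 + rho * lam - lam) / 4 * (z - x) ^+ 2
    + (lam ^+ 2 + 2 * rho ^+ 2 * lam ^+ 2 - lam) / 4 * (z - 2 * y + x) ^+ 2
    + (energy_flux y z - energy_flux x y).
Proof. by rewrite /step_energy /energy_flux; field. Qed.

Lemma sum_step_energy_le (u : nat -> R) (N : nat) :
  0 <= lam -> `|nu| <= 1 ->
  nu ^+ 2 + rho * lam - lam <= 0 ->
  lam ^+ 2 + 2 * rho ^+ 2 * lam ^+ 2 - lam <= 0 ->
  u 0 = 0 -> u N.+1 = 0 ->
  \sum_(i < N) step_energy (u i) (u i.+1) (u i.+2)
    <= \sum_(i < N) u i.+1 ^+ 2.
Proof.
move=> lam0; rewrite ler_norml => /andP[nu1 nu2] c0 c1 u0 uN.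
(* The condition [u N.+1 = 0] cannot survive an induction on [N], so the flux through the right end
   is carried along; the zero end values are inserted only afterwards. *)
have H : \sum_(i < N) step_energy (u i) (u i.+1) (u i.+2) <=
    \sum_(i < N) u i.+1 ^+ 2
    + (energy_flux (u N) (u N.+1) - energy_flux (u 0) (u 1)).
  elim: N {uN} => [|n IH]; first by rewrite !big_ord0 subrr addr0.
  rewrite !big_ord_recr/=.
  have := lerD IH (lexx (step_energy (u n) (u n.+1) (u n.+2))).
  move=> /le_trans; apply; rewrite [in leLHS]step_energyE.
  have := sqr_ge0 (u n.+2 - u n); have := sqr_ge0 (u n.+2 - 2 * u n.+1 + u n).
  move: (_ ^+ 2) => p p0; move: ((u n.+2 - u n) ^+ 2) => q q0.
  have : (nu ^+ 2 + rho * lam - lam) / 4 * q <= 0.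
    by rewrite mulr_le0_ge0// pmulr_lle0// invr_gt0.
  have : (lam ^+ 2 + 2 * rho ^+ 2 * lam ^+ 2 - lam) / 4 * p <= 0.
    by rewrite mulr_le0_ge0// pmulr_lle0// invr_gt0.
  lra.
apply: (le_trans H); rewrite gerDl u0 uN /energy_flux.
have h1 : 0 <= (1 - nu) * (lam / 2 * u 1 ^+ 2).
  by rewrite mulr_ge0 ?subr_ge0// mulr_ge0 ?sqr_ge0// divr_ge0.
have h2 : 0 <= (1 + nu) * (lam / 2 * u N ^+ 2).
  by rewrite mulr_ge0 ?(mulr_ge0 _ (sqr_ge0 _)) ?divr_ge0//; lra.
nra.
Qed.

End energy.

(** * The Fourier symbol and the two coefficients it controls *)

Section symbol.
Variables (R : realType) (mu rho k h : R).
Let lam := k / h ^+ 2.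
Let nu := mu * k / h.

Lemma sqr_normc (x y : R) : Normc.normc (x +i* y)%C ^+ 2 = x ^+ 2 + y ^+ 2.
Proof. by rewrite /= sqr_sqrtr// addr_ge0// sqr_ge0. Qed.

(** The second coefficient bound gives [lam ^+ 2 <= lam], hence [lam <= 1]; the first then gives
    [nu ^+ 2 <= (1 - rho) * lam <= lam <= 1]. *)
Lemma courant_le1 : 0 <= rho -> 0 < k -> 0 < h ->
  nu ^+ 2 + rho * lam - lam <= 0 ->
  lam ^+ 2 + 2 * rho ^+ 2 * lam ^+ 2 - lam <= 0 -> `|nu| <= 1.
Proof.
move=> rho0 k0 h0 c0 c1.
have lam0 : 0 < lam by rewrite divr_gt0// exprn_gt0.
have r0 : 0 <= rho * lam by rewrite mulr_ge0// ltW.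
have r1 : 0 <= rho ^+ 2 * lam ^+ 2 by rewrite mulr_ge0 ?sqr_ge0.
have lam1 : lam <= 1.
  rewrite -(ler_pM2l lam0) mulr1 -expr2; lra.
rewrite -(@ler_pXn2r _ 2) ?nnegrE// expr1n real_normK ?num_real//; lra.
Qed.

(** The terms with [rho] cancel in [a + c], whose real part becomes [1 - 2 * lam * s]; the
    half-angle identity [sin theta ^+ 2 = 4 * s * (1 - s)] makes the rest polynomial in [s]. *)
Lemma amplificationE theta : 0 <= rho * k ->
  let s := sin (theta / 2) ^+ 2 in
  amplification mu rho k h theta = 1 + 4 * s *
    ((nu ^+ 2 + rho * lam - lam) * (1 - s)
     + (lam ^+ 2 + 2 * rho ^+ 2 * lam ^+ 2 - lam) * s).
Proof.
move=> rk s; rewrite /amplification /symbol_a /symbol_b /symbol_c.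
have -> : 1 - 'i%C * ((mu * k / h * sin theta)%:C)%C -
    ((2 * (1 - rho) * k / h ^+ 2 * sin (theta / 2) ^+ 2)%:C)%C
    + - ((2 * rho * k / h ^+ 2 * sin (theta / 2) ^+ 2)%:C)%C
  = ((1 - 2 * lam * s) +i* (- (nu * sin theta)))%C.
  by apply/eqP; rewrite eq_complex /=; apply/andP; split; apply/eqP;
    rewrite /nu /lam /s; ring.
have -> : - ('i%C * ((Num.sqrt (rho * k) / h * sin theta)%:C)%C)
  = (0 +i* (- (Num.sqrt (rho * k) / h * sin theta)))%C.
  by apply/eqP; rewrite eq_complex /=; apply/andP; split; apply/eqP; ring.
have -> : - ((2 * rho * k / h ^+ 2 * sin (theta / 2) ^+ 2)%:C)%C
  = ((- (2 * rho * lam * s)) +i* 0)%C.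
  by apply/eqP; rewrite eq_complex /=; apply/andP; split; apply/eqP;
    rewrite /lam /s; ring.
rewrite !sqr_normc !sqrrN !exprMn sqr_sqrtr// exprVn.
have -> : sin theta ^+ 2 = 4 * s * (1 - s).
  have -> : sin theta = cos (theta / 2) * sin (theta / 2) *+ 2.
    by rewrite -sin_mulr2n -[_ *+ 2]mulr_natr divfK.
  have -> : 1 - s = cos (theta / 2) ^+ 2.
    by rewrite cos2sin2.
  by rewrite /s -mulr_natr; ring.
by rewrite -[sin _ ^+ 2]/s /lam; ring.
Qed.

(** The angle [2 * asin (sqrt s)] lies in [[- pi, pi]] and realises any [s] in [[0, 1]], so the
    supremum bound becomes a sign condition on a polynomial in [s]; the value [s = 1] isolates
    [c1]. *)
Lemma fourier_stable_coef_le0 : 0 <= rho * k -> fourier_stable mu rho k h ->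
  nu ^+ 2 + rho * lam - lam <= 0 /\
  lam ^+ 2 + 2 * rho ^+ 2 * lam ^+ 2 - lam <= 0.
Proof.
move=> rk st; set c0 := (X in X <= 0 /\ _); set c1 := (X in _ /\ X <= 0).
have key s : 0 <= s <= 1 -> 4 * s * (c0 * (1 - s) + c1 * s) <= 0.
  move=> /andP[s0 s1].
  have r01 : 0 <= Num.sqrt s <= 1.
    by rewrite sqrtr_ge0/= -[leRHS]sqrtr1 ler_wsqrtr.
  have r11 : -1 <= Num.sqrt s <= 1 by lra.
  have th : - pi <= asin (Num.sqrt s) * 2 <= pi.
    by have := asin_geNpi2 r11; have := asin_lepi2 r11; lra.
  have : ((amplification mu rho k h (asin (Num.sqrt s) * 2))%:E <= 1)%E.
    by apply: le_trans st; apply: ereal_sup_ubound;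
      exists (asin (Num.sqrt s) * 2).
  rewrite lee_fin amplificationE//= mulfK// asinK ?in_itv//= sqr_sqrtr//.
  by rewrite gerDl.
have k1 := key 1 _; rewrite lexx ler01 in k1; have {k1} := k1 isT => k1.
have c1le : c1 <= 0 by lra.
(* The bracket equals [c0] at [s = 0], but the factor [4 * s] vanishes there, so a positive [c0] has
   to be refuted at some [s > 0]. *)
split => //; rewrite leNgt; apply/negP => c0gt.
(* s chosen so that c0 (1 - s) + c1 s = c0 / 2 *)
pose s := c0 / (2 * (c0 - c1)).
have d0 : 0 < 2 * (c0 - c1) by lra.
have s0 : 0 < s by rewrite divr_gt0.
have s1 : s <= 1 by rewrite ler_pdivrMr//; lra.
have := key s _; rewrite (ltW s0) s1 => /(_ isT).
have -> : c0 * (1 - s) + c1 * s = c0 / 2 by rewrite /s; field; lra.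
by rewrite leNgt !mulr_gt0 ?invr_gt0.
Qed.

End symbol.

(** * Second moment of a quadratic polynomial in a standard normal variable *)

Section gaussian.
Variable R : realType.
Notation leb := (@lebesgue_measure R).
Notation phi := (normal_pdf (0 : R) 1).

(** The Radon-Nikodym derivative of the normal law and [normal_pdf] have equal integrals over every
    measurable set, hence agree almost everywhere; the change of variables for the former thus
    passes to the latter. *)
Lemma ge0_integral_normal_prob (m sigma : R) (f : R -> \bar R) :
  measurable_fun setT f -> (forall x, 0 <= f x)%E ->
  (\int[normal_prob m sigma]_x f x
   = \int[leb]_x (f x * (normal_pdf m sigma x)%:E))%E.
Proof.
move=> mf f0; have dom := normal_prob_dominates m sigma.
rewrite -(Radon_Nikodym_SigmaFinite.change_of_variables dom)//.
have iRN := Radon_Nikodym_SigmaFinite.f_integrable dom.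
apply: ae_eq_integral => //.
- by apply: emeasurable_funM => //; exact: measurable_int iRN.
- apply: emeasurable_funM => //; apply/measurable_EFinP.
  exact: measurable_normal_pdf.
- apply: ae_eqe_mul2l; apply: integral_ae_eq => //.
  + by apply/measurable_EFinP; exact: measurable_normal_pdf.
  + by move=> E _ mE; rewrite -Radon_Nikodym_SigmaFinite.f_integral.
Qed.

Let scale_regularE (x : R) (y : R^o) : x *: y = x * y :> R.
Proof. by []. Qed.

Lemma standard_normal_pdfE x :
  phi x = normal_peak 1 * expR (- x ^+ 2 / 2).
Proof. by rewrite normal_pdfE ?oner_eq0// /normal_fun subr0 expr1n. Qed.

Lemma is_derive_standard_normal_pdf (x : R) : is_derive x 1 phi (- x * phi x).
Proof.
have -> : phi = (fun x => normal_peak 1 * expR (- x ^+ 2 / 2)).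
  by apply/funext => y; rewrite standard_normal_pdfE.
apply: is_derive_eq.
by rewrite !scale_regularE; field.
Qed.

(** From [expR t >= t ^+ 2 / 2] at [t = x ^+ 2 / 2]. The power 3 is the degree of the polynomial
    factor in the primitive [F] used for the moments. *)
Lemma standard_normal_pdf_decay (x : R) : 0 < x ->
  x ^+ 3 * phi x <= 8 * normal_peak 1 / x.
Proof.
move=> x0; rewrite standard_normal_pdfE mulNr expRN.
have e0 := expR_gt0 (x ^+ 2 / 2).
have e1 : x ^+ 4 / 8 <= expR (x ^+ 2 / 2).
  have h0 : 0 <= x ^+ 2 / 2 by rewrite divr_ge0// sqr_ge0.
  apply: le_trans (expR_ge1Dxn 1 h0).
  have -> : (x ^+ 2 / 2) ^+ 2 / 2`!%:R = x ^+ 4 / 8.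
    by rewrite (_ : 2`! = 2)%N//; field.
  by rewrite lerDr.
rewrite mulrCA [8 * _]mulrC -[leRHS]mulrA ler_wpM2l ?normal_peak_ge0//.
rewrite ler_pdivrMr//; apply: (@le_trans _ _ (8 / x * (x ^+ 4 / 8))).
  by rewrite le_eqVlt; apply/orP; left; apply/eqP; field; rewrite gt_eqF.
by rewrite ler_wpM2l// divr_ge0// ltW.
Qed.

(** Encodes the moments 0, 1, 0, 3 of orders 1 to 4. They come all at once from one explicit
    primitive on [[- n, n]], whose boundary terms vanish in the limit. *)
Lemma integral_standard_normal_sqr (a b c : R) :
  (\int[normal_prob 0 1]_x ((a + b * x + c * x ^+ 2) ^+ 2)%:E
   = (a ^+ 2 + b ^+ 2 + 3 * c ^+ 2 + 2 * (a * c))%:E)%E.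
Proof.
set q := fun x : R => (a + b * x + c * x ^+ 2) ^+ 2.
set C := _ + _.
have mq : measurable_fun setT q.
  apply: measurable_funX; apply: measurable_funD => //.
    by apply: measurable_funD => //; exact: measurable_funM.
  by apply: measurable_funM => //; exact: measurable_funX.
rewrite ge0_integral_normal_prob; last 2 first.
- exact/measurable_EFinP.
- by move=> x; rewrite lee_fin sqr_ge0.
(* The coefficients solve P' - x P = q - C, so that (P phi)' = (q - C) phi. *)
pose p1 := - (b ^+ 2 + 2 * (a * c)) - 3 * c ^+ 2.
pose P (x : R) := - (2 * (a * b)) - 4 * (b * c) + p1 * x
  - 2 * (b * c) * x ^+ 2 - c ^+ 2 * x ^+ 3.
pose F x := P x * phi x.
have dF (x : R) : is_derive x 1 F ((q x - C) * phi x).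
  have dP : is_derive x 1 P (p1 - 4 * (b * c) * x - 3 * c ^+ 2 * x ^+ 2).
    apply: is_derive_eq.
    rewrite !scale_regularE /p1. by ring.
  have dphi := is_derive_standard_normal_pdf x.
  apply: is_derive_eq.
  by rewrite !scale_regularE /P /q /C /p1; ring.
have cphi : continuous phi by apply: continuous_normal_pdf; exact: oner_neq0.
have cq : continuous q.
  move=> x; apply: cvgM; apply: (@cvgD _ R^o).
  - apply: (@cvgD _ R^o); first exact: cvg_cst.
    by apply: cvgM; [exact: cvg_cst|exact: cvg_id].
  - by apply: cvgM; [exact: cvg_cst|exact: exprn_continuous].
  - apply: (@cvgD _ R^o); first exact: cvg_cst.
    by apply: cvgM; [exact: cvg_cst|exact: cvg_id].
  - by apply: cvgM; [exact: cvg_cst|exact: exprn_continuous].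
have mphi : measurable_fun setT phi := measurable_normal_pdf 0 1.
pose I (n : nat) : set R := `[- n%:R, n%:R]%classic.
have mI n : R.-ocitv.-measurable.-sigma.-measurable (I n).
  exact (measurable_itv _).
have ndI : nondecreasing_seq I.
  move=> m n mn; apply/subsetPset => x; rewrite /I/= !in_itv/=.
  have mn' : (m%:R : R) <= n%:R by rewrite ler_nat.
  by move=> /andP[? ?]; apply/andP; split; lra.
have UI : \bigcup_n I n = setT.
  rewrite -subTset => x _; exists (Num.truncn `|x|).+1 => //.
  rewrite /I/= in_itv/= -ler_norml ltW//.
  exact: Num.Theory.truncnS_gt.
have cvgI (f : R -> R) : measurable_fun setT f -> (forall x, 0 <= f x) ->
    (\int[leb]_(x in I n) (f x)%:E)%E @[n --> \oo]
      --> (\int[leb]_x (f x)%:E)%E.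
  move=> mf f0; rewrite -UI; apply: ge0_nondecreasing_set_cvg_integral => //.
  - by move=> n; apply/measurable_funTS/measurable_EFinP.
  - by move=> n x _; rewrite lee_fin.
(* Here [q] is split as [(q - C) + C], the first part having the primitive [F]. The index [n.+1]
   keeps the interval nondegenerate, as the fundamental theorem of calculus requires. *)
have FTC n : (\int[leb]_(x in I n.+1) (q x * phi x)%:E =
    (F n.+1%:R - F (- n.+1%:R))%:E
    + C%:E * \int[leb]_(x in I n.+1) (phi x)%:E)%E.
  have cg : continuous (fun x => (q x - C) * phi x).
    move=> x; apply: cvgM; last exact: cphi.
    by apply: (@cvgB _ R^o); [exact: cq|exact: cvg_cst].
  have intI (f : R -> R) : continuous f -> leb.-integrable (I n.+1) (EFin \o f).
    move=> cf; apply: continuous_compact_integrable;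
      first exact: segment_compact.
    exact: continuous_subspaceT.
  have n0 : (0 : R) < n.+1%:R by rewrite ltr0n.
  have cF x : F y @[y --> x] --> F x.
    by apply: differentiable_continuous; apply/derivable1_diffP; case: (dF x).
  rewrite EFinB -(@continuous_FTC2 _ (fun x => (q x - C) * phi x)).
  - rewrite -integralZl//; last exact: intI.
    rewrite -integralD//; last 2 first.
    + exact: intI.
    + by apply: integrableZl => //; exact: intI.
    by apply: eq_integral => x _; rewrite -EFinM -EFinD; congr EFin; ring.
  - by rewrite gtrN.
  - exact: continuous_subspaceT.
  - split.
    + by move=> x _; case: (dF x).
    + exact: cvg_at_right_filter.
    + exact: cvg_at_left_filter.
  - by move=> x _; rewrite derive1E; exact: (@derive_val _ _ _ _ _ _ _ (dF x)).
(* As [phi] is even, the even powers in [P] cancel and [p1 * x - c ^+ 2 * x ^+ 3] remains up to a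
   factor 2; for [x >= 1] it is dominated by [x ^+ 3], and the decay bound gives [K / x]. *)
have F0 : F n.+1%:R - F (- n.+1%:R) @[n --> \oo] --> (0 : R).
  pose K := 2 * (`|p1| + c ^+ 2) * (8 * normal_peak 1).
  apply: norm_cvg0.
  apply: (@squeeze_cvgr _ _ _ _ (fun=> 0) (fun n => K * n.+1%:R^-1)).
  - near=> n; rewrite normr_ge0/=.
    set x : R := n.+1%:R.
    have x1 : 1 <= x by rewrite ler1n.
    have x0 : 0 < x by rewrite (lt_le_trans ltr01).
    have -> : F x - F (- x) = 2 * (p1 * x - c ^+ 2 * x ^+ 3) * phi x.
      by rewrite /F !standard_normal_pdfE sqrrN /P; ring.
    have d := standard_normal_pdf_decay x0.
    rewrite 2!normrM [`|phi x|]ger0_norm ?normal_pdf_ge0// [`|2|]ger0_norm//.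
    have b1 : `|p1 * x - c ^+ 2 * x ^+ 3| <= (`|p1| + c ^+ 2) * x ^+ 3.
      apply: (le_trans (ler_normB _ _)).
      rewrite (normrM p1) (normrM (c ^+ 2)).
      rewrite [`|x|]ger0_norm ?(ltW x0)// [`|c ^+ 2|]ger0_norm ?sqr_ge0//.
      rewrite [`|x ^+ 3|]ger0_norm ?exprn_ge0 ?(ltW x0)// mulrDl lerD2r.
      by rewrite ler_wpM2l// -[leLHS]expr1 ler_weXn2l.
    apply: (@le_trans _ _ (2 * (`|p1| + c ^+ 2) * (x ^+ 3 * phi x))).
      rewrite -mulrA -[leRHS]mulrA; apply: ler_wpM2l => //.
      by rewrite [leRHS]mulrA; apply: ler_wpM2r => //; exact: normal_pdf_ge0.
    rewrite /K -[leRHS]mulrA; apply: ler_wpM2l d.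
    by rewrite mulr_ge0// addr_ge0// sqr_ge0.
  - exact: cvg_cst.
  - rewrite -(mulr0 K); apply: cvgM; first exact: cvg_cst.
    exact: cvg_harmonic.
(* Monotone convergence is applied to [q * phi] and [phi] separately, both being nonnegative,
   whereas [(q - C) * phi] may change sign. *)
have L : (\int[leb]_(x in I n.+1) (q x * phi x)%:E)%E @[n --> \oo]
    --> (\int[leb]_x (q x * phi x)%:E)%E.
  rewrite (cvg_shiftS (fun n => \int[leb]_(x in I n) (q x * phi x)%:E)%E).
  apply: cvgI; first exact: measurable_funM.
  by move=> x; rewrite mulr_ge0 ?normal_pdf_ge0// sqr_ge0.
have M : (\int[leb]_(x in I n.+1) (phi x)%:E)%E @[n --> \oo]
    --> (\int[leb]_x (phi x)%:E)%E.
  rewrite (cvg_shiftS (fun n => \int[leb]_(x in I n) (phi x)%:E)%E).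
  by apply: cvgI => // x; exact: normal_pdf_ge0.
rewrite integral_normal_pdf in M.
under eq_integral do rewrite -EFinM.
have F0' : (F n.+1%:R - F (- n.+1%:R))%:E @[n --> \oo] --> (0%:E : \bar R).
  by apply: cvg_EFin; [exact: nearW|exact: F0].
have M' : (C%:E * \int[leb]_(x in I n.+1) (phi x)%:E)%E @[n --> \oo]
    --> (C%:E * 1)%E.
  by apply: cvgeZl.
have L' : (\int[leb]_(x in I n.+1) (q x * phi x)%:E)%E @[n --> \oo]
    --> (0%:E + C%:E * 1)%E.
  by rewrite (funext FTC); apply: (cvgeD _ F0' M').
rewrite add0e mule1 in L'.
by rewrite (cvg_unique _ L L').
Unshelve. all: by end_near. Qed.

Lemma ge0_integral_standard_normal d (T : measurableType d)
    (P : probability T R) (X : {RV P >-> R}) (f : R -> \bar R) :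
  standard_normal X -> measurable_fun setT f -> (forall x, 0 <= f x)%E ->
  (\int[P]_w f (X w) = \int[normal_prob 0 1]_x f x)%E.
Proof.
move=> nX mf f0.
have mX : measurable_fun setT (X : T -> measurableTypeR R).
  exact: (measurable_funPT X).
pose X' : {mfun T >-> measurableTypeR R} :=
  HB.pack (X : T -> measurableTypeR R) (isMeasurableFun.Build _ _ _ _ _ mX).
transitivity (\int[distribution P X']_x f x)%E.
  by rewrite (@ge0_integral_distribution _ _ _ _ _ P X').
by apply: eq_measure_integral => B mB _; exact: nX.
Qed.

End gaussian.

(** * Integrating out a variable independent of the past *)

Section freezing.
Context d (T : measurableType d) (R : realType) (P : probability T R).
Variables (G : set (set T)) (Y : {RV P >-> R}).
Hypotheses (Gm : G `<=` measurable) (GT : G setT) (GI : setI_closed G).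
Hypothesis indep : forall A B, G A -> measurable B ->
  P (A `&` Y @^-1` B) = (P A * P (Y @^-1` B))%E.

(** Both sides are finite measures in [A], a restriction and a rescaling of [P]; they agree on the
    pi-system [G], which contains the whole space, hence on the sigma-algebra it generates. *)
Lemma g_sigma_algebra_independent A B : <<s G >> A -> measurable B ->
  P (A `&` Y @^-1` B) = (P A * P (Y @^-1` B))%E.
Proof.
move=> sA mB.
have mYB : measurable (Y @^-1` B).
  by rewrite -[X in measurable X]setTI; exact: measurable_funP.
have r0 : 0 <= fine (P (Y @^-1` B)) by exact: fine_ge0.
have fP : (fine (P (Y @^-1` B)))%:E = P (Y @^-1` B).
  by rewrite fineK// fin_num_measure.
have mscaleE C : mscale (NngNum r0) P C = (P C * P (Y @^-1` B))%E.
  by rewrite /mscale/= fP muleC.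
rewrite -mscaleE -[LHS]/(mrestr P mYB A).
apply: (g_sigma_algebra_measure_unique G Gm (fun=> setT)) => //.
- by rewrite bigcup_const.
- by move=> C GC; rewrite [RHS]mscaleE -indep.
- by move=> _; rewrite /= /mrestr setTI ltey_eq fin_num_measure.
Qed.

(** The past is modelled by the identity map into [T] with the coarser sigma-algebra generated by
    [G]. By independence, the joint law of this map and [Y] agrees with the product law on
    rectangles, hence everywhere, and Tonelli separates the integrals. *)
Lemma ge0_integral_independent
    (g : g_sigma_algebraType G * R -> \bar R) :
  measurable_fun setT g -> (forall z, 0 <= g z)%E ->
  (\int[P]_w g (w, Y w) = \int[P]_w \int[P]_w' g (w, Y w'))%E.
Proof.
move=> mg g0.
have mid : measurable_fun setT (idfun : T -> g_sigma_algebraType G).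
  move=> _ A mA; rewrite setTI preimage_id.
  exact: (smallest_sub (@sigma_algebra_measurable _ T) Gm).
pose idRV : {mfun T >-> g_sigma_algebraType G} :=
  HB.pack (idfun : T -> g_sigma_algebraType G)
    (isMeasurableFun.Build _ _ _ _ _ mid).
have mp : measurable_fun setT
    (fun w => (idfun w, Y w) : g_sigma_algebraType G * R).
  exact: measurable_fun_pair.
pose pRV : {mfun T >-> (g_sigma_algebraType G * R)%type} :=
  HB.pack (fun w => (idfun w, Y w) : g_sigma_algebraType G * R)
    (isMeasurableFun.Build _ _ _ _ _ mp).
transitivity (\int[distribution P pRV]_z g z)%E.
  by rewrite (@ge0_integral_distribution _ _ _ _ _ P pRV).
transitivity (\int[distribution P idRV \x distribution P Y]_z g z)%E.
  apply/esym/eq_measure_integral => A mA _.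
  apply: product_measure_unique => // B C mB mC.
  exact: g_sigma_algebra_independent.
rewrite fubini_tonelli1//.
rewrite (@ge0_integral_distribution _ _ _ _ _ P idRV)//.
- apply: eq_integral => w _; rewrite /= /fubini_F.
  rewrite (@ge0_integral_distribution _ _ _ _ _ P Y)//.
  exact: (measurableT_comp mg (measurable_pair1 _)).
- exact: measurable_fun_fubini_tonelli_F.
- by move=> w; exact: integral_ge0.
Qed.

End freezing.

(** * The information available before each time step *)

Section history.
Context d (T : measurableType d) (R : realType) (P : probability T R).
Variables (m : nat) (V : 'I_m -> T -> R) (Z : nat -> {RV P >-> R}).
Hypothesis mV : forall i, measurable_fun setT (V i).
Hypothesis indepZ : mutually_independent P (fun n => Z n : T -> R).
Hypothesis indepV : independent_classes P (g_sigma_preimage V)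
  (sigma_sequence (fun n => Z n : T -> R)).

(* A pi-system generating the information available before [Z n] is drawn. *)
Definition history (n : nat) : set (set T) :=
  [set C | exists A (B : nat -> set R), [/\ g_sigma_preimage V A,
    (forall i, measurable (B i)) &
    C = A `&` \bigcap_(i in [set` iota 0 n]) (Z i @^-1` B i)]].

Let GV : set (set T) := g_sigma_preimage V.

Let GVI : setI_closed GV.
Proof. by move=> A B; exact: (@measurableI _ (g_sigma_algebraType _)). Qed.

Let GVT : GV setT.
Proof. exact: (@measurableT _ (g_sigma_algebraType _)). Qed.

Let mZ i B : measurable B -> measurable (Z i @^-1` B).
Proof.
by move=> mB; rewrite -[X in measurable X]setTI; exact: measurable_funP.
Qed.

Let GVm : GV `<=` measurable.
Proof.
apply: smallest_sub; first exact: sigma_algebra_measurable.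
move=> A; rewrite -bigcup_seq => -[i _ [B mB <-]].
exact: mV.
Qed.

Lemma history_setT n : history n setT.
Proof.
exists setT, (fun=> setT); split => //.
by rewrite setTI; apply/esym; apply/seteqP; split.
Qed.

Lemma history_setI n : setI_closed (history n).
Proof.
move=> _ _ [A [B [GA mB ->]]] [A' [B' [GA' mB' ->]]].
exists (A `&` A'), (fun i => B i `&` B' i); split.
- exact: GVI.
- by move=> i; exact: measurableI.
- by rewrite setIACA -bigcapI.
Qed.

Lemma history_measurable n : history n `<=` measurable.
Proof.
move=> _ [A [B [GA mB ->]]]; apply: measurableI; first exact: GVm.
by apply: fin_bigcap_measurable => // i _; exact: mZ.
Qed.

Let sigma_sequence_bigcap (s : seq nat) (B : nat -> set R) :
  (forall i, measurable (B i)) ->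
  sigma_sequence (fun n => Z n : T -> R)
    (\bigcap_(i in [set` s]) (Z i @^-1` B i)).
Proof.
move=> mB; apply: (@fin_bigcap_measurable _ (g_sigma_algebraType _)) => // i _.
apply: sub_sigma_algebra; exists i => //; exists (B i) => //.
by rewrite setTI.
Qed.

(** The event of [Z n] joins the cylinder of the earlier increments. Independence of [V] from the
    whole sequence splits off [A0] on both sides, and mutual independence factors the cylinders. *)
Lemma history_independent n A B : history n A -> measurable B ->
  P (A `&` Z n @^-1` B) = (P A * P (Z n @^-1` B))%E.
Proof.
move=> [A0 [B0 [GA mB0 ->]]] mB.
(* One family of sets must serve both index lists; as [n] is not in [iota 0 n], overwriting slot [n]
   leaves the past cylinder unchanged. *)
pose B1 i := if i == n then B else B0 i.
have mB1 i : measurable (B1 i) by rewrite /B1; case: ifP.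
have nN : n \notin iota 0 n by rewrite mem_iota ltnn andbF.
have E1 : \bigcap_(i in [set` iota 0 n]) (Z i @^-1` B0 i)
    = \bigcap_(i in [set` iota 0 n]) (Z i @^-1` B1 i).
  apply: eq_bigcapr => i /= iI; rewrite /B1; case: eqP => // ni.
  by rewrite ni (negbTE nN) in iI.
have E2 : \bigcap_(i in [set` iota 0 n]) (Z i @^-1` B0 i) `&` Z n @^-1` B
    = \bigcap_(i in [set` n :: iota 0 n]) (Z i @^-1` B1 i).
  have -> : [set` n :: iota 0 n] = n |` [set` iota 0 n].
    apply/seteqP; split => [i /=|i /= []]; rewrite inE.
    - by move=> /orP[/eqP ->|]; [left|right].
    - by move=> ->; rewrite eqxx.
    - by move=> ->; rewrite orbT.
  rewrite bigcap_setU1 -E1 setIC; congr (_ `&` _).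
  by rewrite /B1 eqxx.
rewrite -setIA E2 indepV//; last exact: sigma_sequence_bigcap.
rewrite E1 indepV//; last exact: sigma_sequence_bigcap.
rewrite !indepZ ?iota_uniq//; last by rewrite /= nN iota_uniq.
by rewrite big_cons /B1 eqxx -/B1 -muleA; congr (_ * _)%E; exact: muleC.
Qed.

Lemma history_measurable_fun_V n i :
  measurable_fun setT (V i : g_sigma_algebraType (history n) -> R).
Proof.
move=> _ B mB; rewrite setTI; apply: sub_sigma_algebra.
exists (V i @^-1` B), (fun=> setT); split => //.
- apply: sub_sigma_algebra; rewrite -bigcup_seq; exists i;
    first exact: mem_index_enum.
  by exists B => //; rewrite setTI.
- by rewrite [X in _ `&` X](_ : _ = setT) ?setIT//; apply/seteqP; split.
Qed.

Lemma history_measurable_fun_Z n i : (i < n)%N ->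
  measurable_fun setT (Z i : g_sigma_algebraType (history n) -> R).
Proof.
move=> ltin _ B mB; rewrite setTI; apply: sub_sigma_algebra.
exists setT, (fun j => if j == i then B else setT); split => //.
- by move=> j; case: ifP.
- rewrite setTI; apply/seteqP; split => [w Bw j _|w /(_ i)] /=.
    by case: eqP => // ->.
  by rewrite eqxx mem_iota ltin; exact.
Qed.

Lemma ge0_integral_history n
    (g : g_sigma_algebraType (history n) * R -> \bar R) :
  measurable_fun setT g -> (forall z, 0 <= g z)%E ->
  (\int[P]_w g (w, Z n w)
   = \int[P]_w \int[P]_w' g (w, Z n w'))%E.
Proof.
apply: ge0_integral_independent.
- exact: history_measurable.
- exact: history_setT.
- exact: history_setI.
- exact: history_independent.
Qed.

End history.

(** * Energy balance of the Milstein scheme *)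

Lemma interior_vector_sqr (R : realType) (T : Type) (J : nat)
    (v : nat -> nat -> T -> R) (n : nat) (w : T) :
  ((interior_vector J v n w)^T *m interior_vector J v n w) 0 0
    = \sum_(i < J.-1) v n i.+1 w ^+ 2.
Proof. by rewrite !mxE; apply: eq_bigr => i _; rewrite !mxE expr2. Qed.

Section milstein.
Context d (T : measurableType d) (R : realType) (P : probability T R).
Variables (mu rho k h : R) (J : nat) (Z : nat -> {RV P >-> R})
  (v : nat -> nat -> T -> R).
Hypothesis J_gt0 : (0 < J)%N.
Hypothesis scheme : milstein_scheme mu rho k h J (fun n => Z n : T -> R) v.

Let v0 : 'I_(J.-1) -> T -> R := fun j => v 0%N j.+1.

(** Adaptedness: [v m] is built from the initial data and [Z i] with [i < m]. Keeping [n] fixed with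
    [m <= n] lets the induction on [m] stay in a single sigma-algebra; [vb] disposes of the constant
    boundary values. *)
Lemma milstein_measurable_history n m j : (m <= n)%N -> (j <= J)%N ->
  measurable_fun setT (v m j : g_sigma_algebraType (history v0 Z n) -> R).
Proof.
have [bnd rec] := scheme.
have vb p i : (i <= J)%N -> (forall i, (1 <= i <= J.-1)%N ->
    measurable_fun setT (v p i : g_sigma_algebraType (history v0 Z n) -> R)) ->
  measurable_fun setT (v p i : g_sigma_algebraType (history v0 Z n) -> R).
  move=> iJ mi; have [->|i0] := eqVneq i 0%N.
    by rewrite (_ : v p 0%N = cst 0)//; apply/funext => w; case: (bnd p w).
  have [->|iNJ] := eqVneq i J.
    by rewrite (_ : v p J = cst 0)//; apply/funext => w; case: (bnd p w).
  apply: mi; rewrite lt0n i0/= -ltnS prednK//.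
  by rewrite ltn_neqAle iNJ.
elim: m j => [|m IH] j mn jJ; apply: vb => // {jJ}j /andP[j1 jJ].
  have jJ' : (j.-1 < J.-1)%N by rewrite prednK.
  have : measurable_fun setT
      (v0 (Ordinal jJ') : g_sigma_algebraType (history v0 Z n) -> R).
    exact: history_measurable_fun_V.
  by rewrite /v0/= prednK.
have jJ' : (j < J)%N by rewrite -(prednK J_gt0) ltnS.
have mj i : (i <= J)%N ->
    measurable_fun setT (v m i : g_sigma_algebraType (history v0 Z n) -> R).
  by apply: IH; exact: ltnW.
have mZ : measurable_fun setT (Z m : g_sigma_algebraType (history v0 Z n) -> R).
  exact: history_measurable_fun_Z.
rewrite (_ : v m.+1 j = fun w => v m j w
      - (mu * k + Num.sqrt (rho * k) * Z m w) / (2 * h)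
        * (v m j.+1 w - v m j.-1 w)
      + ((1 - rho) * k + rho * k * Z m w ^+ 2) / (2 * h ^+ 2)
        * (v m j.+1 w - 2 * v m j w + v m j.-1 w)); last first.
  by apply/funext => w; rewrite rec// j1.
have m1 := mj j (ltnW jJ').
have m2 := mj j.+1 jJ'.
have m3 := mj j.-1 (leq_trans (leq_pred _) (ltnW jJ')).
apply: measurable_funD; [apply: measurable_funB => //|]; apply: measurable_funM.
- apply: measurable_funM => //; apply: measurable_funD => //.
  exact: measurable_funM.
- exact: measurable_funB.
- apply: measurable_funM => //; apply: measurable_funD => //.
  by apply: measurable_funM => //; exact: measurable_funX.
- apply: measurable_funD => //; apply: measurable_funB => //.
  exact: measurable_funM.
Qed.

Hypothesis mv0 : forall j, (1 <= j <= J.-1)%N -> measurable_fun setT (v 0%N j).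
Hypothesis normalZ : forall n, standard_normal (Z n).
Hypothesis indepZ : mutually_independent P (fun n => Z n : T -> R).
Hypothesis indep0 : independent_classes P (g_sigma_preimage v0)
  (sigma_sequence (fun n => Z n : T -> R)).
Hypotheses (rk_ge0 : 0 <= rho * k) (h_neq0 : h != 0).

Let mv0' (i : 'I_(J.-1)) : measurable_fun setT (v0 i).
Proof. by apply: mv0; rewrite ltn_ord. Qed.

(** Given the past, each new value is a quadratic polynomial in [Z n], so the past is frozen and the
    Gaussian second moment applied at each grid point. *)
Lemma milstein_step_energy n :
  (\int[P]_w (\sum_(i < J.-1) v n.+1 i.+1 w ^+ 2)%:E
   = \int[P]_w (\sum_(i < J.-1) step_energy (k / h ^+ 2) (mu * k / h) rho
       (v n i w) (v n i.+1 w) (v n i.+2 w))%:E)%E.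
Proof.
have [bnd rec] := scheme.
pose A i w := v n i.+2 w - v n i w.
pose L i w := v n i.+2 w - 2 * v n i.+1 w + v n i w.
(* The coefficients of [1], [Z n] and [Z n ^+ 2] in the scheme, all determined by the past. *)
pose a i w := v n i.+1 w - mu * k / h / 2 * A i w
  + (1 - rho) * k / (2 * h ^+ 2) * L i w.
pose b i w := - (Num.sqrt (rho * k) / (2 * h)) * A i w.
pose c i w := rho * k / (2 * h ^+ 2) * L i w.
pose q i w z := (a i w + b i w * z + c i w * z ^+ 2) ^+ 2.
pose X := g_sigma_algebraType (history v0 Z n).
pose g (z : X * R) : \bar R := (\sum_(i < J.-1) q i z.1 z.2)%:E.
have mq (i : 'I_(J.-1)) : measurable_fun setT (fun z : X * R => q i z.1 z.2).
  have iJ : (i.+2 <= J)%N by have := ltn_ord i; rewrite -ltnS prednK.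
  have mvi j : (j <= J)%N -> measurable_fun setT (fun z : X * R => v n j z.1).
    move=> jJ; apply: (measurableT_comp (f := v n j : X -> R)) => //.
    exact: milstein_measurable_history.
  have m0 := mvi i (ltnW (ltnW iJ)); have m1 := mvi i.+1 (ltnW iJ).
  have m2 := mvi i.+2 iJ.
  have mA : measurable_fun setT (fun z : X * R => A i z.1).
    exact: measurable_funB.
  have mL : measurable_fun setT (fun z : X * R => L i z.1).
    apply: measurable_funD => //; apply: measurable_funB => //.
    exact: measurable_funM.
  apply: measurable_funX; apply: measurable_funD; first apply: measurable_funD.
  - apply: measurable_funD; last exact: measurable_funM.
    by apply: measurable_funB => //; exact: measurable_funM.
  - by apply: measurable_funM => //; exact: measurable_funM.
  - apply: measurable_funM; first exact: measurable_funM.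
    exact: measurable_funX.
have mg : measurable_fun setT g.
  by apply/measurable_EFinP; exact: measurable_sum.
have q0 i w z : 0 <= q i w z by exact: sqr_ge0.
have g0 z : (0 <= g z)%E by rewrite lee_fin sumr_ge0.
transitivity (\int[P]_w g (w, Z n w))%E.
  apply: eq_integral => w _; congr EFin; apply: eq_bigr => i _.
  rewrite rec ?ltn_ord// /q /a /b /c /A /L /=.
  by congr (_ ^+ 2); field.
rewrite (ge0_integral_history mv0' indepZ indep0 mg g0).
apply: eq_integral => w _.
rewrite (@ge0_integral_standard_normal _ _ _ P (Z n) (fun y => g (w, y)))//;
  last exact: (measurableT_comp mg (measurable_pair1 _)).
rewrite /g/=; under eq_integral do rewrite -sumEFin.
rewrite ge0_integral_sum//; last 2 first.
- move=> i; apply/measurable_EFinP.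
  exact: (measurableT_comp (mq i) (measurable_pair1 _)).
- by move=> i z _; rewrite lee_fin.
rewrite -sumEFin; apply: eq_bigr => i _.
(* The moment equals [(a + c) ^+ 2 + b ^+ 2 + 2 * c ^+ 2], the grid counterpart of [amplification];
   again [rho] cancels in [a + c]. *)
rewrite integral_standard_normal_sqr; congr EFin.
have -> : b i w ^+ 2 = rho * k / (4 * h ^+ 2) * A i w ^+ 2.
  rewrite /b exprMn sqrrN expr_div_n sqr_sqrtr// exprMn.
  by congr (_ / (_ * _) * _); rewrite -natrX.
by rewrite /a /c /step_energy -/(A i w) -/(L i w); field.
Qed.

(** Once [Z n] is averaged out, the inequality holds for each outcome [w] separately, and
    monotonicity of the integral concludes. *)
Lemma milstein_energy_le n : 0 <= rho -> 0 < k -> 0 < h ->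
  fourier_stable mu rho k h ->
  (\int[P]_w (\sum_(i < J.-1) v n.+1 i.+1 w ^+ 2)%:E
   <= \int[P]_w (\sum_(i < J.-1) v n i.+1 w ^+ 2)%:E)%E.
Proof.
move=> rho0 k0 h0 stab.
have [bnd rec] := scheme.
have [c0 c1] := fourier_stable_coef_le0 rk_ge0 stab.
have nu1 := courant_le1 rho0 k0 h0 c0 c1.
have lam0 : 0 <= k / h ^+ 2 by rewrite divr_ge0 ?exprn_ge0 ?ltW.
have mv j : (j <= J)%N -> measurable_fun setT (v n j).
  move=> jJ _ B mB.
  apply: (smallest_sub (@sigma_algebra_measurable _ T)
    (history_measurable mv0' (n := n))).
  exact: milstein_measurable_history.
have mvi (i : 'I_(J.-1)) : [/\ measurable_fun setT (v n i),
    measurable_fun setT (v n i.+1) & measurable_fun setT (v n i.+2)].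
  have iJ : (i.+2 <= J)%N by have := ltn_ord i; rewrite -ltnS prednK.
  by split; apply: mv => //; [exact: ltnW (ltnW iJ)|exact: ltnW].
rewrite milstein_step_energy; apply: ge0_le_integral => //.
- move=> w _; rewrite lee_fin sumr_ge0// => i _.
  have ? : 0 <= rho * (k / h ^+ 2) by rewrite mulr_ge0.
  rewrite /step_energy addr_ge0//; last by rewrite mulr_ge0 ?sqr_ge0.
  by rewrite addr_ge0 ?sqr_ge0// mulr_ge0 ?sqr_ge0// divr_ge0.
- apply/measurable_EFinP; apply: measurable_sum => i.
  have [m0 m1 m2] := mvi i.
  have mA : measurable_fun setT (fun w => v n i.+2 w - v n i w).
    exact: measurable_funB.
  have mL : measurable_fun setT
      (fun w => v n i.+2 w - 2 * v n i.+1 w + v n i w).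
    apply: measurable_funD => //; apply: measurable_funB => //.
    exact: measurable_funM.
  apply: measurable_funD; first apply: measurable_funD.
  + apply: measurable_funX; apply: measurable_funD; last exact: measurable_funM.
    by apply: measurable_funB => //; exact: measurable_funM.
  + by apply: measurable_funM => //; exact: measurable_funX.
  + apply: measurable_funM => //; apply: measurable_funX.
    exact: measurable_funM.
- apply/measurable_EFinP; apply: measurable_sum => i.
  by have [_ m1 _] := mvi i; exact: measurable_funX.
- move=> w _; rewrite lee_fin.
  (* Used with [N = J.-1], so that [u 0] and [u N.+1] are the Dirichlet values at grid points [0]
     and [J]. *)
  apply: (@sum_step_energy_le _ _ _ _ (fun j => v n j w)) => //.
  + by case: (bnd n w).
  + by rewrite prednK//; case: (bnd n w).
Qed.

End milstein.

(** * Mean-square stability of the initial-boundary value problem *)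

Theorem mainTheorem4 (R : realType) (mu rho xmax : R)
    (hrho : 0 <= rho <= 1) (hxmax : 0 < xmax) :
  exists2 delta : R, 0 < delta &
    forall (k : R) (J : nat) (h : R),
      0 < k -> (2 <= J)%N -> h = xmax / J%:R ->
      h < delta -> k / h < delta ->
      fourier_stable mu rho k h ->
      forall (d : measure_display) (T : measurableType d)
        (P : probability T R)
        (Z : nat -> {RV P >-> R}) (v : nat -> nat -> T -> R),
        (forall n, standard_normal (Z n)) ->
        mutually_independent P (fun n => Z n : T -> R) ->
        (forall j, (1 <= j <= J.-1)%N -> v 0%N j \in Lfun P 2%:E) ->
        independent_classes P
          (g_sigma_preimage (fun j : 'I_(J.-1) => v 0%N j.+1))
          (sigma_sequence (fun n => Z n : T -> R)) ->
        milstein_scheme mu rho k h J (fun n => Z n : T -> R) v ->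
        forall n : nat,
          let V := interior_vector J v in
          ('E_P[fun w => (((V n.+1 w)^T *m V n.+1 w) 0 0)%R]
             <= 'E_P[fun w => (((V n w)^T *m V n w) 0 0)%R])%E.
Proof.
have /andP[rho0 _] := hrho.
(* The value [1] for [delta] is an arbitrary positive choice. *)
exists 1 => // k J h k0 J2 hE _ _ stab d T P Z v normalZ indepZ v0L2 indep0
  scheme n /=.
have J0 : (0 < J)%N by exact: leq_trans J2.
have h0 : 0 < h by rewrite hE divr_gt0// ltr0n.
rewrite unlock.
under eq_integral do rewrite interior_vector_sqr.
under [leRHS]eq_integral do rewrite interior_vector_sqr.
apply: (milstein_energy_le J0 scheme _ normalZ) => //.
- move=> j jJ; have /andP[+ _] := v0L2 j jJ.
  by rewrite inE.
- by rewrite mulr_ge0// ltW.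
- by rewrite gt_eqF.
Qed.
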